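(* Let $\gamma$ be a $3$-Frenet helix, with constant curvatures $\kappa,\tau$, in any semi-Riemannian manifold $M^m_t$ of dimension $m\ge3$ and index $t$, $1\le t\le m-1$. If $$\epsilon_1\kappa^2+\epsilon_3\tau^2=0,$$ then $\gamma$ is proper $r$-harmonic for all $r\ge4$.
   Context: Conventions. For a semi-Riemannian manifold $(M,\langle\,,\rangle)$ with Levi-Civita connection $\nabla$, $R(X,Y)Z=\nabla_X\nabla_YZ-\nabla_Y\nabla_XZ-\nabla_{[X,Y]}Z$. Curves $\gamma:I\to M$ ($I$ an open real interval) are smooth, nonnull, parametrized by arc length; $T=\gamma'$. Put $\nabla_T^0T=T$, $\nabla_T^jT=\nabla_T(\nabla_T^{j-1}T)$. For $r\ge2$, $\gamma$ is $r$-harmonic if $$\tau_r(\gamma)=\nabla^{2r-1}_T T+\sum_{\ell=0}^{r-2}(-1)^\ell R\big(\nabla^{2r-3-\ell}_T T,\nabla^{\ell}_T T\big)T=0,$$ and proper $r$-harmonic if it is $r$-harmonic and not a geodesic. A $3$-Frenet curve is a curve admitting a frame $\{F_1=T,F_2=N,F_3=B\}$ along it with $\langle F_i,F_i\rangle=\epsilon_i=\pm1$, $\langle F_i,F_j\rangle=0$ for $i\ne j$, and $\nabla_TT=\epsilon_2kN$, $\nabla_TN=-\epsilon_1kT+\epsilon_3\tau B$, $\nabla_TB=-\epsilon_2\tau N$, where $k(s)$ and $\tau(s)$ are positive functions (if $m=3$ and the manifold is oriented, $\tau$ is allowed to take any real value, $B$ being fixed by requiring the frame to be positively oriented). It is a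 helix if the curvatures are constant, denoted $\kappa,\tau$. *)

(* Defs.v *)
From HB Require Import structures.
From mathcomp Require Import all_boot all_order all_algebra.
From mathcomp Require Import all_classical all_reals all_analysis.
From mathcomp Require Import ring lra.
Set Implicit Arguments.
Unset Strict Implicit.
Unset Printing Implicit Defensive.
Import Order.TTheory GRing.Theory Num.Theory.
Import numFieldNormedType.Exports.
Local Open Scope classical_set_scope.
Local Open Scope ring_scope.

(* The sets U below are always open. *)
Fixpoint Ck (R : realType) (V W : normedModType R) (k : nat) (U : set V)
    (f : V -> W) : Prop :=
  match k with
  | 0 => forall x, U x -> {for x, continuous f}
  | k'.+1 => (forall x, U x -> differentiable f x) /\
             (forall v, Ck k' U (fun x => 'D_v f x))
  end.

Definition smooth (R : realType) (V W : normedModType R) (U : set V)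
  (f : V -> W) : Prop := forall k, Ck k U f.

(* A manifold is given by an atlas: the chart [a] is the homeomorphism
   [coord a] from the open set [chart_dom a] onto an open set of R^m, with
   inverse [param a]. The values of [coord a] and [param a] outside these
   open sets are irrelevant. *)
Record manifold (R : realType) (m : nat) := Manifold {
  space :> topologicalType;
  chart : Type;
  chart_dom : chart -> set space;
  coord : chart -> space -> 'rV[R]_m;
  param : chart -> 'rV[R]_m -> space;
  manifold_hausdorff : hausdorff_space space;
  manifold_second_countable : @second_countable space;
  chart_cover : forall p, exists a, chart_dom a p;
  chart_dom_open : forall a, open (chart_dom a);
  chart_im_open : forall a, open (coord a @` chart_dom a);
  coordK : forall a p, chart_dom a p -> param a (coord a p) = p;
  coord_continuous : forall a p, chart_dom a p -> {for p, continuous (coord a)};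
  param_continuous : forall a x, (coord a @` chart_dom a) x ->
    {for x, continuous (param a)};
  transition_smooth : forall a b,
    smooth (coord a @` (chart_dom a `&` chart_dom b)) (coord b \o param a)
}.

Section Manifold.
Context {R : realType} {m : nat}.
Implicit Types M : manifold R m.

(* Coordinates of tangent vectors are row vectors, so [jacobian], which acts on
   the right, sends the coordinates in the chart [a] to those in [b]. *)
Definition change_mx M (a b : chart M) (p : M) : 'M[R]_m :=
  jacobian (coord b \o param a) (coord a p).

Definition negative_on (G W : 'M[R]_m) : Prop :=
  forall w : 'rV[R]_m, (w <= W)%MS -> w != 0 -> (w *m G *m w^T) 0 0 < 0.

(* The index of a symmetric bilinear form is the largest dimension of a
   subspace (here the row space of W) on which it is negative definite. *)
Definition has_index (G : 'M[R]_m) (t : nat) : Prop :=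
  (exists2 W : 'M[R]_m, negative_on G W & \rank W = t) /\
  (forall W : 'M[R]_m, negative_on G W -> (\rank W <= t)%N).

(* [gram a x] is the matrix (g_ij) of the metric in the chart [a], at the point
   of coordinates x. *)
Record metric M (t : nat) := Metric {
  gram : chart M -> 'rV[R]_m -> 'M[R]_m;
  gram_smooth : forall a, smooth (coord a @` chart_dom a) (gram a);
  gram_sym : forall a p, chart_dom a p ->
    (gram a (coord a p))^T = gram a (coord a p);
  gram_unit : forall a p, chart_dom a p -> gram a (coord a p) \in unitmx;
  gram_index : forall a p, chart_dom a p -> has_index (gram a (coord a p)) t;
  gram_change : forall a b p, chart_dom a p -> chart_dom b p ->
    gram a (coord a p) =
      change_mx a b p *m gram b (coord b p) *m (change_mx a b p)^T
}.

(* G is the matrix of the metric in the coordinates of a chart. *)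
Section Coordinates.
Variable G : 'rV[R]_m -> 'M[R]_m.
Implicit Types (X Y Z : 'rV[R]_m -> 'rV[R]_m) (x u v w : 'rV[R]_m).

Definition unit_vec (i : 'I_m) : 'rV[R]_m := delta_mx 0 i.

Definition partial_gram (i j k : 'I_m) x : R :=
  'D_(unit_vec i) (fun y => G y j k) x.

(* The Christoffel symbol Gamma^k_ij. *)
Definition christoffel x (k i j : 'I_m) : R :=
  2^-1 * \sum_l invmx (G x) k l *
    (partial_gram i j l x + partial_gram j i l x - partial_gram l i j x).

Definition Gamma x u v : 'rV[R]_m :=
  \row_k \sum_i \sum_j christoffel x k i j * u 0 i * v 0 j.

Definition nabla X Y : 'rV[R]_m -> 'rV[R]_m :=
  fun x => 'D_(X x) Y x + Gamma x (X x) (Y x).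

Definition lie_bracket X Y : 'rV[R]_m -> 'rV[R]_m :=
  fun x => 'D_(X x) Y x - 'D_(Y x) X x.

Definition curvature_field X Y Z : 'rV[R]_m -> 'rV[R]_m :=
  fun x => nabla X (nabla Y Z) x - nabla Y (nabla X Z) x
           - nabla (lie_bracket X Y) Z x.

(* R(u,v)w at x; as R is a tensor, the extensions of u, v and w to vector fields
   may be chosen with constant coordinates. *)
Definition curvature x u v w : 'rV[R]_m :=
  curvature_field (cst u) (cst v) (cst w) x.

(* The next lemmas show that the Christoffel symbols define the unique
   torsion-free connection compatible with the metric. *)
Definition partial_gram_sym x := forall i j k,
  partial_gram i j k x = partial_gram i k j x.

Lemma christoffel_sym x k i j :
  partial_gram_sym x -> christoffel x k i j = christoffel x k j i.
Proof.
move=> sG; rewrite /christoffel; congr (_ * _); apply: eq_bigr => l _.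
by rewrite (sG l i j) [partial_gram i j l x + _]addrC.
Qed.

Lemma nabla_torsion_free X Y x : partial_gram_sym x ->
  nabla X Y x - nabla Y X x = lie_bracket X Y x.
Proof.
move=> sG; rewrite /nabla /lie_bracket.
have -> : Gamma x (Y x) (X x) = Gamma x (X x) (Y x).
  apply/rowP => k; rewrite !mxE exchange_big; apply: eq_bigr => i _.
  by apply: eq_bigr => j _; rewrite (christoffel_sym k j i sG) mulrAC.
by rewrite opprD addrACA subrr addr0.
Qed.

Lemma christoffel_lower x i j n : G x \in unitmx ->
  \sum_k G x n k * christoffel x k i j =
  2^-1 * (partial_gram i j n x + partial_gram j i n x - partial_gram n i j x).
Proof.
move=> uG; rewrite /christoffel.
under eq_bigr do rewrite mulrCA mulr_sumr.
rewrite -mulr_sumr exchange_big /=; congr (_ * _).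
under eq_bigr do under eq_bigr do rewrite mulrA.
under eq_bigr do rewrite -mulr_suml.
rewrite (bigD1 n) //= [X in _ + X]big1 ?addr0.
  have := congr1 (fun A : 'M[R]_m => A n n) (mulmxV uG).
  by rewrite !mxE eqxx => ->; rewrite mul1r.
move=> l ln; have := congr1 (fun A : 'M[R]_m => A n l) (mulmxV uG).
by rewrite !mxE eq_sym (negbTE ln) => ->; rewrite mul0r.
Qed.

Lemma christoffel_metric x i j n : G x \in unitmx -> partial_gram_sym x ->
  partial_gram n i j x = \sum_k G x j k * christoffel x k n i
                       + \sum_k G x i k * christoffel x k n j.
Proof.
move=> uG sG; rewrite !christoffel_lower // (sG i n j) (sG j n i) (sG n j i).
by field.
Qed.

Lemma christoffel_unique x (C : 'I_m -> 'I_m -> 'I_m -> R) :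
  G x \in unitmx -> partial_gram_sym x ->
  (forall k i j, C k i j = C k j i) ->
  (forall n i j, partial_gram n i j x =
     \sum_k G x j k * C k n i + \sum_k G x i k * C k n j) ->
  forall k i j, C k i j = christoffel x k i j.
Proof.
move=> uG sG sC mC k i j.
have E n : (G x *m \col_k C k i j) n 0 = (G x *m \col_k christoffel x k i j) n 0.
  rewrite !mxE.
  under [RHS]eq_bigr do rewrite mxE.
  under [LHS]eq_bigr do rewrite mxE.
  rewrite christoffel_lower // !mC.
  have S a b c : \sum_k G x a k * C k b c = \sum_k G x a k * C k c b.
    by apply: eq_bigr => l _; rewrite sC.
  rewrite (S j n i) (S i n j) (S n j i).
  by field.
have /(congr1 (mulmx (invmx (G x)))) :
    G x *m \col_k C k i j = G x *m \col_k christoffel x k i j.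
  by apply/colP => n; exact: E.
by rewrite !mulKmx // => /colP/(_ k); rewrite !mxE.
Qed.

End Coordinates.

Lemma metric_partial_gram_sym M t (g : metric M t) (a : chart M) (p : M) :
  chart_dom a p -> partial_gram_sym (gram g a) (coord a p).
Proof.
move=> ap i j k; rewrite /partial_gram; apply: near_eq_derive.
have : nbhs (coord a p) (coord a @` chart_dom a).
  by apply: open_nbhs_nbhs; split; [exact: chart_im_open | exists p].
apply: filterS => _ [q aq <-].
by rewrite -[in LHS](gram_sym g aq) mxE.
Qed.

Section Curves.
Context {M : manifold R m} {t : nat}.
Variables (g : metric M t) (I : set R) (gam : R -> M).

(* A vector field along gam is given by its coordinates in each chart; [V a s]
   is only meaningful when I s and chart_dom a (gam s). *)
Implicit Types V W : chart M -> R -> 'rV[R]_m.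

Definition at_coord (a : chart M) (s : R) : 'rV[R]_m := coord a (gam s).

Definition field_along V : Prop :=
  (forall a, smooth (I `&` gam @^-1` chart_dom a) (V a)) /\
  (forall a b s, I s -> chart_dom a (gam s) -> chart_dom b (gam s) ->
     V b s = V a s *m change_mx a b (gam s)).

Definition eq_along V W : Prop :=
  forall s, I s -> forall a, chart_dom a (gam s) -> V a s = W a s.

Definition inner V W (a : chart M) (s : R) : R :=
  (V a s *m gram g a (at_coord a s) *m (W a s)^T) 0 0.

Definition inner_along V W (c : R) : Prop :=
  forall s, I s -> forall a, chart_dom a (gam s) -> inner V W a s = c.

Definition velocity : chart M -> R -> 'rV[R]_m :=
  fun a s => derive1 (at_coord a) s.

Definition cov_deriv V : chart M -> R -> 'rV[R]_m := fun a s =>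
  derive1 (V a) s + Gamma (gram g a) (at_coord a s) (velocity a s) (V a s).

Definition cov_deriv_iter (j : nat) : chart M -> R -> 'rV[R]_m :=
  iter j cov_deriv velocity.

Definition smooth_curve : Prop :=
  [/\ open I, is_interval I, I !=set0,
      (forall s, I s -> {for s, continuous gam}) &
      forall a, smooth (I `&` gam @^-1` chart_dom a) (at_coord a)].

(* Nonnull and parametrized by arc length. *)
Definition unit_speed : Prop :=
  forall s, I s -> forall a, chart_dom a (gam s) ->
    `|inner velocity velocity a s| = 1.

Definition geodesic : Prop := eq_along (cov_deriv_iter 1) (fun _ _ => 0).

(* The subtractions on nat are exact for 2 <= r. *)
Definition tau_field (r : nat) : chart M -> R -> 'rV[R]_m := fun a s =>
  cov_deriv_iter (2 * r - 1)%N a s +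
  \sum_(0 <= l < (r - 1)%N) (-1) ^+ l *:
    curvature (gram g a) (at_coord a s)
      (cov_deriv_iter (2 * r - 3 - l)%N a s) (cov_deriv_iter l a s)
      (velocity a s).

Definition r_harmonic (r : nat) : Prop := eq_along (tau_field r) (fun _ _ => 0).

Definition proper_r_harmonic (r : nat) : Prop := r_harmonic r /\ ~ geodesic.

(* An orientation of M tells, for each p, whether the basis of coordinate
   vectors of the chart [a] at p is positive (1) or negative (-1). *)
Definition orientation (o : chart M -> M -> R) : Prop :=
  [/\ (forall a p, chart_dom a p -> o a p = 1 \/ o a p = -1),
      (forall a p, chart_dom a p -> {for p, continuous (o a)}) &
      forall a b p, chart_dom a p -> chart_dom b p ->
        0 < o a p * o b p * \det (change_mx a b p)].

(* Used for m = 3 only. *)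
Definition positive_frame (o : chart M -> M -> R) T N B : Prop :=
  forall s, I s -> forall a, chart_dom a (gam s) ->
    0 < o a (gam s) * \det (\matrix_(i < m) [:: T a s; N a s; B a s]`_i).

Definition sign (e : R) : Prop := e = 1 \/ e = -1.

(* The torsion is positive, except that on an oriented 3-manifold it may take
   any real value, the sign of B being then fixed by the orientation. *)
Record frenet3 (eps1 eps2 eps3 : R) (N B : chart M -> R -> 'rV[R]_m)
    (k tau : R -> R) : Prop := Frenet3 {
  frenet_curve : smooth_curve;
  frenet_unit_speed : unit_speed;
  frenet_N : field_along N;
  frenet_B : field_along B;
  frenet_sign1 : sign eps1;
  frenet_sign2 : sign eps2;
  frenet_sign3 : sign eps3;
  frenet_TT : inner_along velocity velocity eps1;
  frenet_NN : inner_along N N eps2;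
  frenet_BB : inner_along B B eps3;
  frenet_TN : inner_along velocity N 0;
  frenet_TB : inner_along velocity B 0;
  frenet_NB : inner_along N B 0;
  frenet_DT : eq_along (cov_deriv velocity) (fun a s => (eps2 * k s) *: N a s);
  frenet_DN : eq_along (cov_deriv N)
    (fun a s => - (eps1 * k s) *: velocity a s + (eps3 * tau s) *: B a s);
  frenet_DB : eq_along (cov_deriv B) (fun a s => - (eps2 * tau s) *: N a s);
  frenet_k_gt0 : forall s, I s -> 0 < k s;
  frenet_tau_sign :
    (forall s, I s -> 0 < tau s) \/
    (m = 3 /\ exists2 o, orientation o & positive_frame o velocity N B)
}.

Definition helix3 (eps1 eps2 eps3 : R) (N B : chart M -> R -> 'rV[R]_m)
    (kappa tau : R) : Prop :=
  frenet3 eps1 eps2 eps3 N B (cst kappa) (cst tau).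

End Curves.
End Manifold.

(* Main.v *)
Require Import Defs.
From mathcomp Require Import all_boot all_order all_algebra.
From mathcomp Require Import all_classical all_reals all_analysis.
From mathcomp Require Import ring zify.
Import Order.TTheory GRing.Theory Num.Theory.
Import numFieldNormedType.Exports.
Local Open Scope ring_scope.

(** Differentiating the Frenet equations twice gives
    nabla_T^3 T = - kappa (eps1 kappa^2 + eps3 tau^2) N = 0, so that nabla_T^j T = 0
    for all j >= 3. For r >= 4 every term of tau_r contains such a factor: the
    leading one because 2r - 1 >= 3, the curvature ones because l <= r - 2 gives
    2r - 3 - l >= r - 1 >= 3. *)

Section Connection.
Context {R : realType} {m : nat}.
Implicit Types (G : 'rV[R]_m -> 'M[R]_m) (x u v w : 'rV[R]_m).

Lemma Gamma0l G x v : Gamma G x 0 v = 0.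
Proof.
apply/rowP => k; rewrite !mxE big1 // => i _; rewrite big1 // => j _.
by rewrite !mxE mulr0 mul0r.
Qed.

Lemma GammaD G x u v w : Gamma G x u (v + w) = Gamma G x u v + Gamma G x u w.
Proof.
apply/rowP => k; rewrite !mxE -big_split; apply: eq_bigr => i _ /=.
by rewrite -big_split; apply: eq_bigr => j _; rewrite !mxE mulrDr.
Qed.

Lemma GammaZ G x u v (c : R) : Gamma G x u (c *: v) = c *: Gamma G x u v.
Proof.
apply/rowP => k; rewrite !mxE mulr_sumr; apply: eq_bigr => i _.
by rewrite mulr_sumr; apply: eq_bigr => j _; rewrite !mxE mulrCA.
Qed.

Lemma Gamma0r G x u : Gamma G x u 0 = 0.
Proof. by rewrite -[in LHS](scale0r (0 : 'rV[R]_m)) GammaZ scale0r. Qed.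

Lemma nabla0l G X : nabla G (cst 0) X = cst 0.
Proof. by apply/funext => x; rewrite /nabla /= derive0 Gamma0l addr0. Qed.

Lemma nabla0r G X : nabla G X (cst 0) = cst 0.
Proof. by apply/funext => x; rewrite /nabla /= derive_cst Gamma0r addr0. Qed.

(** Constant fields have zero bracket, so each of the three terms is a [nabla] in the direction 0 or
    of the zero field. The derivative in the direction 0 vanishes for every function. *)
Lemma curvature0l G x v w : curvature G x 0 v w = 0.
Proof.
have E : lie_bracket (cst 0) (cst v) = cst 0 :> ('rV[R]_m -> 'rV[R]_m).
  by apply/funext => y; rewrite /lie_bracket /= !derive_cst subr0.
by rewrite /curvature /curvature_field E !nabla0l nabla0r /= !subr0.
Qed.

End Connection.

Section AlongCurve.
Context {R : realType} {m t : nat} {M : manifold R m}.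
Variables (g : metric M t) (I : set R) (gam : R -> M).
Implicit Types (V W : chart M -> R -> 'rV[R]_m) (a : chart M).

Lemma cov_derivD V W a s : derivable (V a) s 1 -> derivable (W a) s 1 ->
  cov_deriv g gam (fun b u => V b u + W b u) a s =
    cov_deriv g gam V a s + cov_deriv g gam W a s.
Proof.
by move=> dV dW; rewrite /cov_deriv GammaD !derive1E (deriveD dV dW) addrACA.
Qed.

Lemma cov_derivZ V (c : R) a s : derivable (V a) s 1 ->
  cov_deriv g gam (fun b u => c *: V b u) a s = c *: cov_deriv g gam V a s.
Proof. by move=> dV; rewrite /cov_deriv GammaZ !derive1E (deriveZ c dV) scalerDr. Qed.

Lemma cov_deriv0 : cov_deriv g gam (fun _ _ => 0) = fun _ _ => 0.
Proof.
apply/funext => a; apply/funext => s.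
by rewrite /cov_deriv Gamma0r addr0 derive1E derive_cst.
Qed.

Hypothesis gam_smooth : smooth_curve I gam.

(** Turns an identity assumed only where a chart is valid along the curve into one on a
    neighbourhood, which can then be differentiated. *)
Lemma near_chart_dom a s : I s -> chart_dom a (gam s) ->
  \forall u \near s, I u /\ chart_dom a (gam u).
Proof.
case: gam_smooth => oI _ _ cg _ Is as_.
have nI : nbhs s I by apply: open_nbhs_nbhs.
have na : nbhs (gam s) (chart_dom a).
  by apply: open_nbhs_nbhs; split => //; exact: chart_dom_open.
by apply: filterI; [exact: nI | exact: (cg s Is _ na)].
Qed.

Lemma eq_along_cov_deriv V W :
  eq_along I gam V W -> eq_along I gam (cov_deriv g gam V) (cov_deriv g gam W).
Proof.
move=> VW s Is a as_; rewrite /cov_deriv (VW s Is a as_) !derive1E.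
congr (_ + _); apply: near_eq_derive.
by apply: filterS (near_chart_dom a s Is as_) => u [Iu au]; exact: VW.
Qed.

Lemma derivable_velocity a s : I s -> chart_dom a (gam s) ->
  derivable (velocity gam a) s 1.
Proof.
(* Order 2 is taken because [velocity] is already a first derivative of [at_coord]. *)
case: gam_smooth => _ _ _ _ /(_ a 2%N)[_ /(_ 1)[D _]] Is as_.
have -> : velocity gam a = (fun u => 'D_1 (at_coord gam a) u).
  by apply/funext => u; rewrite /velocity derive1E.
by apply: diff_derivable; exact: D.
Qed.

Lemma derivable_field_along V a s : field_along I gam V ->
  I s -> chart_dom a (gam s) -> derivable (V a) s 1.
Proof.
by case=> /(_ a 1%N)[D _] _ Is as_; apply: diff_derivable; exact: D.
Qed.

(** The zero field is parallel, so a vanishing iterate forces all later ones to vanish. *)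
Lemma cov_deriv_iter_eq0 i j : (i <= j)%N ->
  eq_along I gam (cov_deriv_iter g gam i) (fun _ _ => 0) ->
  eq_along I gam (cov_deriv_iter g gam j) (fun _ _ => 0).
Proof.
move=> /subnK <- H; elim: (j - i)%N => [//|n IH].
by have := eq_along_cov_deriv _ _ IH; rewrite cov_deriv0.
Qed.

End AlongCurve.

Section Helix.
Context {R : realType} {m t : nat} {M : manifold R m}.
Variables (g : metric M t) (I : set R) (gam : R -> M).
Variables (eps1 eps2 eps3 : R) (N B : chart M -> R -> 'rV[R]_m) (kappa tau : R).
Hypothesis gam_helix : helix3 g I gam eps1 eps2 eps3 N B kappa tau.

Lemma helix3_cov_deriv3 : eq_along I gam (cov_deriv_iter g gam 3)
  (fun a s => - (kappa * (eps1 * kappa ^+ 2 + eps3 * tau ^+ 2)) *: N a s).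
Proof.
case: gam_helix => sm _ fN fB _ s2 _ _ _ _ _ _ _ DT DN DB _ _.
have e2 : eps2 * eps2 = 1 by case: s2 => ->; ring.
(* The curvatures being constant, only T and B appear here; the derivatives of both are multiples of
   N, hence so is the third iterate. *)
have D2 : eq_along I gam (cov_deriv_iter g gam 2)
    (fun a s => (eps2 * kappa * - (eps1 * kappa)) *: velocity gam a s +
                (eps2 * kappa * (eps3 * tau)) *: B a s).
  move=> s Is a as_; rewrite [LHS](eq_along_cov_deriv g I gam sm _ _ DT s Is a as_).
  rewrite /cst cov_derivZ; last exact: derivable_field_along fN Is as_.
  by rewrite DN // scalerDr !scalerA.
move=> s Is a as_; rewrite [LHS](eq_along_cov_deriv g I gam sm _ _ D2 s Is a as_).
have dT := derivable_velocity I gam sm a s Is as_.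
have dB := derivable_field_along I gam B a s fB Is as_.
rewrite cov_derivD; [|exact: derivableZ..].
rewrite !cov_derivZ // DT // DB // !scalerA -scalerDl; congr (_ *: _).
(* [eps2] occurs once in the outer coefficient and once in the derivative of T or B; isolating its
   square leaves a polynomial identity for [ring]. *)
rewrite [LHS](_ : _ = - (eps2 * eps2) * (kappa * (eps1 * kappa ^+ 2 + eps3 * tau ^+ 2))).
  by rewrite e2 mulN1r.
by rewrite /=; ring.
Qed.

(** At a point of the nonempty interval, a geodesic would satisfy [eps2 * kappa *: N = 0] with both
    scalars nonzero, so N would vanish there, against its squared norm [eps2] being nonzero. *)
Lemma helix3_not_geodesic : ~ geodesic g I gam.
Proof.
case: gam_helix => sm _ _ _ _ s2 _ _ NN _ _ _ _ DT _ _ k0 _ geo.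
have [_ _ [s Is] _ _] := sm; have [a as_] := chart_cover (gam s).
have e2 : eps2 != 0 by case: s2 => ->; rewrite ?oppr_eq0 oner_eq0.
have N0 : N a s = 0.
  have /eqP := DT s Is a as_; rewrite [X in X == _](geo s Is a as_) eq_sym scaler_eq0.
  by rewrite mulf_eq0 (negbTE e2) (gt_eqF (k0 s Is)) => /eqP.
have := NN s Is a as_; rewrite /inner N0 !mul0mx mxE => e20.
by rewrite -e20 eqxx in e2.
Qed.

End Helix.

Theorem proposition1p25 (R : realType) (m t : nat)
    (hm : (3 <= m)%N) (ht : (1 <= t <= m - 1)%N)
    (M : manifold R m) (g : metric M t) (I : set R) (gam : R -> M)
    (eps1 eps2 eps3 : R) (N B : chart M -> R -> 'rV[R]_m) (kappa tau : R)
    (hgam : helix3 g I gam eps1 eps2 eps3 N B kappa tau)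
    (h : eps1 * kappa ^+ 2 + eps3 * tau ^+ 2 = 0) :
  forall r : nat, (4 <= r)%N -> proper_r_harmonic g I gam r.
Proof.
move=> r r4; split; last exact: helix3_not_geodesic hgam.
have D3 : eq_along I gam (cov_deriv_iter g gam 3) (fun _ _ => 0).
  move=> s Is a as_; rewrite (helix3_cov_deriv3 _ _ _ _ _ _ _ _ _ _ hgam) //.
  by rewrite h mulr0 oppr0 scale0r.
have D j : (3 <= j)%N -> eq_along I gam (cov_deriv_iter g gam j) (fun _ _ => 0).
  by move=> j3; apply: cov_deriv_iter_eq0 j3 D3; exact: frenet_curve hgam.
move=> s Is a as_; rewrite /tau_field D //; last by lia.
(* [big_nat] keeps the bound on [l], from which the first argument of the curvature is an iterate of
   order at least 3. *)
rewrite add0r big_nat big1 // => l /andP[_ lr].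
by rewrite D //; [rewrite curvature0l scaler0 | lia].
Qed.
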